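(* Let $X_1,X_2,\ldots$ be i.i.d. real-valued random variables and set $Z_i=|X_i|$. Let $x_{\max}:=\operatorname{ess\,sup} Z_1=\inf\{x\in\mathbb{R}:\mathbb{P}(Z_1\le x)=1\}$ and assume $x_{\max}<\infty$; equivalently, $\mathbb{P}(Z_1\le x_{\max})=1$ and $\mathbb{P}(Z_1>x_{\max}-\varepsilon)>0$ for every $\varepsilon>0$. For each block size $g\ge 1$, with the block $X=(X_1,\dots,X_g)$, let $R_g^\star$ and $R_{\mathrm{PO2},g}^\star$ be the best single-grid risk and the best two-grid risk defined below. Then $$\lim_{g\to\infty}\bigl(R_g^\star-R_{\mathrm{PO2},g}^\star\bigr)=0.$$
   Context: Grid space: $\overline{\mathcal C}:=\{B=(b_0,\dots,b_7):0=b_0\le b_1\le\cdots\le b_6\le b_7=1\}$. For $B\in\overline{\mathcal C}$ and $a\in[0,1]$, $\psi_B(a):=\min_{0\le j\le 7}(a-b_j)^2$. For a block $X=(X_1,\dots,X_g)\in\mathbb{R}^g$ let $M_g:=\max_{1\le i\le g}|X_i|$; if $M_g>0$ put $A_{i,g}:=|X_i|/M_g\in[0,1]$, and if $M_g=0$ put $A_{i,g}:=0$ (zero-block convention, loss zero). The block loss is $L_B^{(g)}(X):=M_g^2\,\frac1g\sum_{i=1}^g\psi_B(A_{i,g})$. Define $R_g^\star:=\min_{B\in\overline{\mathcal C}}\mathbb{E}\,L_B^{(g)}(X)$ and $R_{\mathrm{PO2},g}^\star:=\inf_{B_1,B_2\in\overline{\mathcal C}}\mathbb{E}\bigl[\min\{L_{B_1}^{(g)}(X),L_{B_2}^{(g)}(X)\}\bigr]$.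 *)

(* Defs.v *)
From HB Require Import structures.
From mathcomp Require Import all_boot all_order all_algebra.
From mathcomp Require Import all_classical all_reals all_analysis.
Unset Printing Implicit Defensive.
Import Order.TTheory GRing.Theory Num.Theory.
Local Open Scope classical_set_scope.
Local Open Scope ring_scope.

Definition grid {R : realType} (B : 'I_8 -> R) : Prop :=
  B ord0 = 0 /\ B ord_max = 1 /\
  (forall i j : 'I_8, (i <= j)%N -> B i <= B j).

Definition psi {R : realType} (B : 'I_8 -> R) (a : R) : R :=
  \big[Num.min/(a - B ord0) ^+ 2]_(j < 8) (a - B j) ^+ 2.

Definition blockmax {R : realType} {g : nat} (x : 'I_g -> R) : R :=
  \big[Num.max/0]_(i < g) `|x i|.

Definition normA {R : realType} {g : nat} (x : 'I_g -> R) (i : 'I_g) : R :=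
  if 0 < blockmax x then `|x i| / blockmax x else 0.

Definition blockloss {R : realType} (B : 'I_8 -> R) {g : nat} (x : 'I_g -> R) : R :=
  blockmax x ^+ 2 * (g%:R^-1 * \sum_(i < g) psi B (normA x i)).

(* the block (X_1,...,X_g), with X_1,X_2,... indexed as X 0, X 1, ... *)
Definition Xblock {T : Type} {R : realType} (X : nat -> T -> R) (g : nat) (t : T)
  : 'I_g -> R := fun i => X (nat_of_ord i) t.

(* R_g^* = min over grids of E L_B^{(g)}(X) (written as infimum) *)
Definition Rstar {d : measure_display} {T : measurableType d} {R : realType}
  (P : probability T R) (X : nat -> T -> R) (g : nat) : \bar R :=
  ereal_inf [set (\int[P]_(t in setT) (blockloss B (Xblock X g t))%:E)%E
            | B in [set B : 'I_8 -> R | grid B]].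

Definition RPO2star {d : measure_display} {T : measurableType d} {R : realType}
  (P : probability T R) (X : nat -> T -> R) (g : nat) : \bar R :=
  ereal_inf [set (\int[P]_(t in setT)
                   (Num.min (blockloss BB.1 (Xblock X g t))
                            (blockloss BB.2 (Xblock X g t)))%:E)%E
            | BB in [set BB : ('I_8 -> R) * ('I_8 -> R) | grid BB.1 /\ grid BB.2]].

Definition mutually_independent {d : measure_display} {T : measurableType d}
  {R : realType} (P : probability T R) (X : nat -> T -> R) : Prop :=
  forall (S : seq nat) (A : nat -> set R), uniq S ->
    (forall i, measurable (A i)) ->
    P (\bigcap_(i in [set` S]) (X i @^-1` A i)) =
    (\prod_(i <- S) P (X i @^-1` A i))%E.

Definition identically_distributed {d : measure_display} {T : measurableType d}
  {R : realType} (P : probability T R) (X : nat -> T -> R) : Prop :=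
  forall (i : nat) (A : set R), measurable A ->
    P (X i @^-1` A) = P (X 0%N @^-1` A).

(* Main.v *)
(* All losses are controlled by m = ess sup |X_1|, the almost sure limit of the
   block maximum M_g.  As M ^+ 2 * psi B (z / M) = min_j (z - M b_j) ^+ 2 is
   2m-Lipschitz in M uniformly in the grid, replacing M_g by m costs at most
   2m (m - M_g) in every block loss, and E (m - M_g) tends to 0.  After this
   replacement a block loss is an empirical mean S_B of i.i.d. variables with
   values in [0, m ^+ 2] and mean mu_B, so that Var S_B <= m ^+ 4 / g whatever
   the grid.  Hence E min(S_B1, S_B2) >= min(mu_B1, mu_B2) - o(1) with an error
   independent of B1 and B2: choosing the grid after seeing the block does not
   help, and no uniform law of large numbers is needed. *)
Require Import Defs.
From HB Require Import structures.
From mathcomp Require Import all_boot all_order all_algebra.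
From mathcomp Require Import all_classical all_reals all_analysis.
From mathcomp Require Import measurable_realfun ess_sup_inf.
From mathcomp Require Import ring lra.
Import Order.TTheory GRing.Theory Num.Theory.
Import numFieldNormedType.Exports.
Local Open Scope classical_set_scope.
Local Open Scope ring_scope.

Set Implicit Arguments.
Unset Strict Implicit.
Unset Printing Implicit Defensive.

(** * Deterministic bounds on the block loss *)

Section deterministic_loss.
Context {R : realType}.
Implicit Types (B : 'I_8 -> R) (z M m : R).

(* [phi B z M = M ^+ 2 * psi B (z / M)], but without division, so that it is
   continuous up to [M = 0] *)
Definition phi B z M : R :=
  \big[Num.min/(z - M * B ord0) ^+ 2]_(j < 8) (z - M * B j) ^+ 2.

Lemma phi_ge0 B z M : 0 <= phi B z M.
Proof.
rewrite /phi; elim/big_ind: _ => [|x y x0 y0|i _]; rewrite ?sqr_ge0//.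
by rewrite le_min x0 y0.
Qed.

Lemma phi_le B z M m : grid B -> 0 <= z <= m -> phi B z M <= m ^+ 2.
Proof.
move=> [B0 _] /andP[z0 zm]; apply: (@le_trans _ _ ((z - M * B ord0) ^+ 2)).
  exact: bigmin_le_id.
by rewrite B0 mulr0 subr0 ler_sqr// nnegrE// (le_trans z0).
Qed.

Lemma grid_itv B j : grid B -> 0 <= B j <= 1.
Proof.
move=> [B0 [B1 Bnd]]; rewrite -{1}B0 -B1 !Bnd//=.
exact: leq_ord.
Qed.

Lemma psi_phi B z M : 0 < M -> M ^+ 2 * psi B (z / M) = phi B z M.
Proof.
move=> M0; have M0' : M != 0 by rewrite gt_eqF.
have sqE b : M ^+ 2 * (z / M - b) ^+ 2 = (z - M * b) ^+ 2 by field.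
rewrite /psi (big_morph (fun y => M ^+ 2 * y) (id1 := (z - M * B ord0) ^+ 2)
  (op1 := Num.min)) ?sqE//.
  by apply: eq_bigr => j _; rewrite sqE.
by move=> x y; rewrite minr_pMr// sqr_ge0.
Qed.

(** By difference of squares each term changes by [M - M'] times [b ((M + M') b - 2 z)]. With [b] in
    [0, 1], both [(M + M') b] and [2 z] lie in [0, 2m], so this factor is at most [2 m] in absolute
    value. A bound common to all terms passes to their minimum. *)
Lemma phi_lipschitz B z M M' m : grid B -> 0 <= z <= m -> 0 <= M <= m ->
  0 <= M' <= m -> phi B z M <= phi B z M' + 2 * m * `|M - M'|.
Proof.
move=> gB /andP[z0 zm] /andP[M0 Mm] /andP[M'0 M'm].
have main j :
    (z - M * B j) ^+ 2 <= (z - M' * B j) ^+ 2 + 2 * m * `|M - M'|.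
  have /andP[b0 b1] := grid_itv j gB.
  have -> : (z - M * B j) ^+ 2 =
      (z - M' * B j) ^+ 2 + (M - M') * (B j * ((M + M') * B j - 2 * z)) by ring.
  rewrite lerD2l (le_trans (ler_norm _))// normrM mulrC ler_wpM2r//.
  rewrite normrM (ger0_norm b0) -[leRHS]mul1r ler_pM//.
  rewrite ler_norml; nra.
rewrite /phi; elim/big_rec2: _ => [|j x y _ xy]; first exact: main.
by rewrite addr_minl le_min !ge_min xy main orbT.
Qed.

Lemma blockmax_ge0 {g} (x : 'I_g -> R) : 0 <= blockmax x.
Proof. exact: bigmax_ge_id. Qed.

Lemma le_blockmax {g} (x : 'I_g -> R) i : `|x i| <= blockmax x.
Proof. exact: (le_bigmax_cond _ (fun i => `|x i|)). Qed.

Lemma blockmax_le {g} (x : 'I_g -> R) m :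
  0 <= m -> (forall i, `|x i| <= m) -> blockmax x <= m.
Proof. by move=> m0 xm; apply: bigmax_le. Qed.

Lemma blocklossE B {g} (x : 'I_g -> R) :
  blockloss B x = g%:R^-1 * \sum_(i < g) phi B `|x i| (blockmax x).
Proof.
rewrite /blockloss mulrCA; congr (_ * _); rewrite mulr_sumr.
apply: eq_bigr => i _; rewrite /normA; case: ifPn => [M0|].
  exact: psi_phi.
(* Zero block: all entries are 0 and [phi B 0 0 = 0], in agreement with the zero-loss convention. *)
rewrite -leNgt => M0.
have M0' : blockmax x = 0 by apply/eqP; rewrite eq_le M0 blockmax_ge0.
have := le_blockmax x i; rewrite M0' normr_le0 => /eqP ->.
rewrite expr0n mul0r /phi normr0; apply/esym.
under eq_bigr do rewrite mul0r subr0 expr0n.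
by rewrite mul0r subr0 expr0n; elim/big_ind: _ => // _ _ -> ->; rewrite minxx.
Qed.

Lemma blockloss_ge0 B {g} (x : 'I_g -> R) : 0 <= blockloss B x.
Proof.
by rewrite blocklossE mulr_ge0 ?invr_ge0// sumr_ge0// => i _; exact: phi_ge0.
Qed.

(** Blocks are nonempty here: an empty mean would be 0 whatever [c] is. *)
Lemma mean_le {g} (F : 'I_g.+1 -> R) c :
  (forall i, F i <= c) -> g.+1%:R^-1 * \sum_(i < g.+1) F i <= c.
Proof.
move=> Fc; rewrite mulrC ler_pdivrMr// mulr_natr.
by rewrite -[X in c *+ X]card_ord -sumr_const ler_sum.
Qed.

Lemma mean_leD {g} (F G : 'I_g.+1 -> R) c : (forall i, F i <= G i + c) ->
  g.+1%:R^-1 * \sum_(i < g.+1) F i <= g.+1%:R^-1 * \sum_(i < g.+1) G i + c.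
Proof.
move=> FG; rewrite -lerBlDl -mulrBr -sumrB; apply: mean_le => i.
by rewrite lerBlDl.
Qed.

Lemma blockloss_le B {g} (x : 'I_g.+1 -> R) m : grid B ->
  (forall i, `|x i| <= m) -> blockloss B x <= m ^+ 2.
Proof.
move=> gB xm; rewrite blocklossE; apply: mean_le => i.
by apply: phi_le => //; rewrite normr_ge0 xm.
Qed.

(** Averages [phi_lipschitz] between the scales [blockmax x] and [m], in both directions; the error
    does not depend on [B]. *)
Lemma blockloss_approx B {g} (x : 'I_g.+1 -> R) m : grid B ->
  (forall i, `|x i| <= m) ->
  `|blockloss B x - g.+1%:R^-1 * \sum_(i < g.+1) phi B `|x i| m| <=
  2 * m * (m - blockmax x).
Proof.
move=> gB xm; have m0 : 0 <= m by rewrite (le_trans _ (xm ord0)).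
have Mm := blockmax_le m0 xm; have M0 := blockmax_ge0 x.
have DE : `|m - blockmax x| = m - blockmax x by rewrite ger0_norm// subr_ge0.
rewrite blocklossE ler_distlC lerBlDr; apply/andP; split; apply: mean_leD => i.
- rewrite -DE distrC.
  by apply: phi_lipschitz => //; rewrite ?normr_ge0 ?m0 ?M0 ?xm ?lexx.
- rewrite -DE.
  by apply: phi_lipschitz => //; rewrite ?normr_ge0 ?m0 ?M0 ?xm ?lexx.
Qed.

(** Witness that grids exist, which keeps the infima below [+oo]. *)
Lemma trivial_grid : grid (fun j : 'I_8 => (j == ord_max)%:R : R).
Proof.
split => //; split => // i j ij; rewrite ler_nat; case: eqP => // iE.
suff -> : j = ord_max by rewrite eqxx.
by apply/val_inj/anti_leq; rewrite leq_ord/= -{1}[7%N]/(val (@ord_max 7)) -iE.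
Qed.

End deterministic_loss.

(** * Expectations of bounded random variables and the variance of a mean *)

Section bounded_expectation.
Context {d : measure_display} {T : measurableType d} {R : realType}.
Variable P : probability T R.

(** A class of integrable functions closed under sums, products and minima, so that integrability
    follows from the shape of an expression and expectations can be handled as real numbers. *)
Definition bmfun (f : T -> R) :=
  measurable_fun setT f /\ exists C, forall t, `|f t| <= C.

Lemma bmfun_integrable f : bmfun f -> P.-integrable setT (EFin \o f).
Proof.
move=> [mf [C fC]]; apply: measurable_bounded_integrable => //.
  by rewrite [ltLHS]probability_setT ltry.
by exists C; split; [exact: num_real|move=> x Cx t _; exact: le_trans (ltW Cx)].
Qed.

Lemma bmfun_cst c : bmfun (fun=> c).
Proof. by split; [exact: measurable_cst|exists `|c|]. Qed.

Lemma bmfunD f g : bmfun f -> bmfun g -> bmfun (fun t => f t + g t).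
Proof.
move=> [mf [C fC]] [mg [D gD]]; split; first exact: measurable_funD.
by exists (C + D) => t; rewrite (le_trans (ler_normD _ _))// lerD.
Qed.

Lemma bmfunM f g : bmfun f -> bmfun g -> bmfun (fun t => f t * g t).
Proof.
move=> [mf [C fC]] [mg [D gD]]; split; first exact: measurable_funM.
by exists (C * D) => t; rewrite normrM ler_pM.
Qed.

Lemma bmfunN f : bmfun f -> bmfun (fun t => - f t).
Proof.
move=> [mf [C fC]]; split; first exact: measurable_funN.
by exists C => t; rewrite normrN.
Qed.

Lemma bmfunB f g : bmfun f -> bmfun g -> bmfun (fun t => f t - g t).
Proof. by move=> bf /bmfunN; exact: bmfunD. Qed.

Lemma bmfunX2 f : bmfun f -> bmfun (fun t => f t ^+ 2).
Proof. by move=> bf; under eq_fun do rewrite expr2; exact: bmfunM. Qed.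

Lemma bmfun_sum (I : Type) (s : seq I) (F : I -> T -> R) :
  (forall i, bmfun (F i)) -> bmfun (fun t => \sum_(i <- s) F i t).
Proof.
move=> bF; elim: s => [|i s IH].
  by under eq_fun do rewrite big_nil; exact: bmfun_cst.
by under eq_fun do rewrite big_cons; exact: bmfunD.
Qed.

Lemma bmfun_min f g : bmfun f -> bmfun g ->
  bmfun (fun t => Num.min (f t) (g t)).
Proof.
move=> [mf [C fC]] [mg [D gD]]; split; first exact: measurable_minr.
exists (Num.max C D) => t; rewrite /Num.min; case: ifP => _.
  by rewrite le_max fC.
by rewrite le_max gD orbT.
Qed.

Lemma bmfun_indic (A : set T) : measurable A -> bmfun \1_A.
Proof.
move=> mA; split; first exact: measurable_indic.
by exists 1 => t; rewrite indicE; case: (_ \in _); rewrite ?normr1 ?normr0.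
Qed.

Lemma bmfun_expD f g : bmfun f -> bmfun g ->
  \int[P]_t (f t + g t) = \int[P]_t f t + \int[P]_t g t.
Proof. by move=> bf bg; rewrite RintegralD//; exact: bmfun_integrable. Qed.

Lemma bmfun_expB f g : bmfun f -> bmfun g ->
  \int[P]_t (f t - g t) = \int[P]_t f t - \int[P]_t g t.
Proof. by move=> bf bg; rewrite RintegralB//; exact: bmfun_integrable. Qed.

Lemma bmfun_expZ c f : bmfun f -> \int[P]_t (c * f t) = c * \int[P]_t f t.
Proof. by move=> bf; rewrite RintegralZl//; exact: bmfun_integrable. Qed.

Lemma bmfun_le_exp f g : bmfun f -> bmfun g -> (forall t, f t <= g t) ->
  \int[P]_t f t <= \int[P]_t g t.
Proof.
by move=> bf bg fg; apply: le_Rintegral => //; exact: bmfun_integrable.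
Qed.

Lemma exp_cst c : \int[P]_t c = c :> R.
Proof. by rewrite Rintegral_cst// [X in fine X]probability_setT mulr1. Qed.

Lemma bmfun_exp_le f C : bmfun f -> (forall t, f t <= C) -> \int[P]_t f t <= C.
Proof.
move=> bf fC; rewrite -[leRHS]exp_cst; apply: bmfun_le_exp => //.
exact: bmfun_cst.
Qed.

Lemma bmfun_exp_sum (I : Type) (s : seq I) (F : I -> T -> R) :
  (forall i, bmfun (F i)) ->
  \int[P]_t (\sum_(i <- s) F i t) = \sum_(i <- s) \int[P]_t F i t.
Proof.
move=> bF; elim: s => [|i s IH].
  by under eq_Rintegral do rewrite big_nil; rewrite exp_cst big_nil.
under eq_Rintegral do rewrite big_cons.
by rewrite big_cons bmfun_expD ?IH//; exact: bmfun_sum.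
Qed.

Lemma exp_indic (A : set T) : measurable A -> \int[P]_t \1_A t = fine (P A).
Proof. by move=> mA; rewrite /Rintegral integral_indic// setIT. Qed.

Lemma bmfun_expE f : bmfun f -> (\int[P]_t (f t)%:E)%E = (\int[P]_t f t)%:E.
Proof.
by move=> bf; rewrite fineK// integrable_fin_num//; exact: bmfun_integrable.
Qed.

(** The squared deviation expands into a double sum of products of centred variables.
    Uncorrelatedness kills the off-diagonal terms, and each of the [n.+1] diagonal ones is at most
    [C ^+ 2], since [Y i] and [mu] both lie in [0, C]. *)
Lemma variance_mean_le (Y : nat -> T -> R) mu C n :
    (forall i, measurable_fun setT (Y i)) ->
    (forall i t, 0 <= Y i t <= C) -> 0 <= mu <= C ->
    (forall i, \int[P]_t Y i t = mu) ->
    (forall i j, i != j -> \int[P]_t (Y i t * Y j t) = mu ^+ 2) ->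
  \int[P]_t ((n.+1%:R^-1 * \sum_(i < n.+1) Y i t - mu) ^+ 2)
    <= C ^+ 2 / n.+1%:R.
Proof.
move=> mY Y0C /andP[mu0 muC] EY EYY.
have bY i : bmfun (Y i).
  split=> //; exists C => t; have /andP[Y0 YC] := Y0C i t.
  by rewrite ger0_norm.
pose c i t := Y i t - mu.
have bc i : bmfun (c i) by apply: bmfunB => //; exact: bmfun_cst.
have bcc i j : bmfun (fun t => c i t * c j t) by exact: bmfunM.
have meanE t : (n.+1%:R^-1 * \sum_(i < n.+1) Y i t - mu) ^+ 2 =
    n.+1%:R ^- 2 * \sum_(i < n.+1) \sum_(j < n.+1) c i t * c j t.
  have n0 : n.+1%:R != 0 :> R by rewrite pnatr_eq0.
  have -> : \sum_(i < n.+1) \sum_(j < n.+1) c i t * c j t =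
      (\sum_(i < n.+1) c i t) ^+ 2.
    by rewrite expr2 mulr_suml; apply: eq_bigr => i _; rewrite mulr_sumr.
  rewrite /c sumrB sumr_const card_ord -mulr_natr.
  by field; rewrite addrC natr1 n0.
under eq_Rintegral do rewrite meanE.
rewrite bmfun_expZ; last first.
  by apply: bmfun_sum => i; apply: bmfun_sum => j; exact: bcc.
rewrite bmfun_exp_sum; last by move=> i; apply: bmfun_sum => j; exact: bcc.
under eq_bigr do rewrite bmfun_exp_sum//.
have off i j : i != j -> \int[P]_t (c i t * c j t) = 0.
  (* Grouped so that the expectation is [mu ^+ 2 - mu * (mu + mu - mu) = 0]. *)
  move=> ij; have cE t : c i t * c j t =
      Y i t * Y j t - mu * (Y i t + Y j t - mu) by rewrite /c; ring.
  under eq_Rintegral do rewrite cE.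
  rewrite bmfun_expB; last 2 first.
  - exact: bmfunM.
  - apply: bmfunM; first exact: bmfun_cst.
    by apply: bmfunB; [exact: bmfunD|exact: bmfun_cst].
  rewrite EYY// bmfun_expZ; last first.
    by apply: bmfunB; [exact: bmfunD|exact: bmfun_cst].
  rewrite bmfun_expB; [|exact: bmfunD|exact: bmfun_cst].
  by rewrite bmfun_expD// !EY exp_cst; ring.
have diag i : \int[P]_t (c i t * c i t) <= C ^+ 2.
  apply: bmfun_exp_le => // t; rewrite -expr2 /c.
  have /andP[Y0 YC] := Y0C i t; nra.
rewrite mulrC ler_pdivrMr ?exprn_gt0//.
have -> : C ^+ 2 / n.+1%:R * n.+1%:R ^+ 2 = \sum_(i < n.+1) C ^+ 2 :> R.
  have n0 : n.+1%:R != 0 :> R by rewrite pnatr_eq0.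
  rewrite sumr_const card_ord -mulr_natr; field.
  by rewrite addrC natr1 n0.
(* In row [i] only the diagonal term survives. *)
apply: ler_sum => i _; rewrite (bigD1 i)//= big1 ?addr0// => j ji.
by apply: off; rewrite eq_sym.
Qed.

End bounded_expectation.

(** * Consequences of independence and identical distribution *)

Section independence.
Context {d : measure_display} {T : measurableType d} {R : realType}.
Variables (P : probability T R) (X : nat -> T -> R).
Hypotheses (Xmeas : forall i, measurable_fun setT (X i))
  (Xind : mutually_independent P X) (Xid : identically_distributed P X).

Lemma independent_setI i j (A B : set R) : i != j -> measurable A ->
  measurable B ->
  P (X i @^-1` A `&` X j @^-1` B) = (P (X i @^-1` A) * P (X j @^-1` B))%E.
Proof.
(* Mutual independence takes a whole family of sets; only its values at [i] and [j] matter. *)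
move=> ij mA mB; pose C k := if k == i then A else B.
have mC k : measurable (C k) by rewrite /C; case: ifP.
have uS : uniq [:: i; j] by rewrite /= inE ij.
have := Xind uS mC; rewrite !big_cons big_nil mule1 /C eqxx.
rewrite [j == i]eq_sym (negbTE ij) => <-; congr (P _).
apply/seteqP; split=> t /=.
  move=> [At Bt] k; rewrite /= !inE => /orP[]/eqP ->; rewrite ?eqxx//.
  by rewrite eq_sym (negbTE ij).
move=> Ct; split.
  by have := Ct i; rewrite /= !inE eqxx; exact.
by have := Ct j; rewrite /= !inE eqxx orbT eq_sym (negbTE ij); exact.
Qed.

(** The joint law of [(X i, X j)] is the product of the marginal laws, so Tonelli's theorem factors
    the integral of [f x * f y]. *)
Lemma ge0_integral_independentM i j (f : R -> R) : i != j ->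
    measurable_fun setT f -> (forall x, 0 <= f x) ->
  (\int[P]_t (f (X i t) * f (X j t))%:E =
   \int[P]_t (f (X i t))%:E * \int[P]_t (f (X j t))%:E)%E.
Proof.
move=> ij mf f0.
have mXij : measurable_fun setT (fun t => (X i t, X j t)).
  exact: measurable_fun_pair.
pose Xi : {mfun T >-> R} :=
  HB.pack (X i) (isMeasurableFun.Build _ _ _ _ _ (Xmeas i)).
pose Xj : {mfun T >-> R} :=
  HB.pack (X j) (isMeasurableFun.Build _ _ _ _ _ (Xmeas j)).
pose Xij : {mfun T >-> (R * R)%type} :=
  HB.pack (fun t => (X i t, X j t)) (isMeasurableFun.Build _ _ _ _ _ mXij).
pose h (z : R * R) := ((f z.1 * f z.2)%:E : \bar R).
have mh : measurable_fun setT h.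
  apply/measurable_EFinP; apply: measurable_funM.
    exact: measurableT_comp.
  exact: measurableT_comp.
have h0 z : (0 <= h z)%E by rewrite lee_fin mulr_ge0.
have mfE : measurable_fun setT (EFin \o f) by exact/measurable_EFinP.
have fE0 y : (0 <= (EFin \o f) y)%E by rewrite lee_fin.
transitivity (\int[distribution P Xij]_z h z)%E.
  by rewrite ge0_integral_distribution.
transitivity (\int[(distribution P Xi \x distribution P Xj)]_z h z)%E.
  (* The product measure is determined by its values on rectangles, where independence applies. *)
  apply: eq_measure_integral => A mA _; apply/esym/product_measure_unique => //.
  by move=> B C mB mC; rewrite -independent_setI.
rewrite fubini_tonelli1// /fubini_F.
under eq_integral => x _.
  rewrite /h /=; under eq_integral do rewrite EFinM.
  rewrite ge0_integralZl//; [|by move=> y _; rewrite lee_fin|exact: fE0].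
  over.
rewrite ge0_integralZr//=; [|by move=> y _; rewrite lee_fin|]; last first.
  by apply: integral_ge0 => y _; rewrite lee_fin.
congr (_ * _)%E.
  by rewrite (@ge0_integral_distribution _ _ _ _ _ _ Xi (EFin \o f)).
by rewrite (@ge0_integral_distribution _ _ _ _ _ _ Xj (EFin \o f)).
Qed.

Lemma ge0_integral_identically_distributed i (f : R -> R) :
    measurable_fun setT f -> (forall x, 0 <= f x) ->
  (\int[P]_t (f (X i t))%:E = \int[P]_t (f (X 0%N t))%:E)%E.
Proof.
move=> mf f0.
have mfE : measurable_fun setT (EFin \o f) by exact/measurable_EFinP.
have fE0 y : (0 <= (EFin \o f) y)%E by rewrite lee_fin.
pose Xi : {mfun T >-> R} :=
  HB.pack (X i) (isMeasurableFun.Build _ _ _ _ _ (Xmeas i)).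
pose X0 : {mfun T >-> R} :=
  HB.pack (X 0%N) (isMeasurableFun.Build _ _ _ _ _ (Xmeas 0%N)).
transitivity (\int[distribution P Xi]_z (f z)%:E)%E.
  by rewrite (@ge0_integral_distribution _ _ _ _ _ _ Xi (EFin \o f)).
transitivity (\int[distribution P X0]_z (f z)%:E)%E; last first.
  by rewrite (@ge0_integral_distribution _ _ _ _ _ _ X0 (EFin \o f)).
by apply: eq_measure_integral => A mA _; exact: Xid.
Qed.

(** With [A] the set where [|x| <= c], this gives the distribution function of the block maximum. *)
Lemma independent_bigcap n (A : set R) : measurable A ->
  P (\bigcap_(i in `I_n) X i @^-1` A) = (P (X 0%N @^-1` A) ^+ n)%E.
Proof.
move=> mA; have := @Xind (iota 0 n) (fun=> A) (iota_uniq _ _) (fun=> mA).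
rewrite (eq_bigr (fun=> P (X 0%N @^-1` A))) => [|i _]; last exact: Xid.
rewrite big_const_seq count_predT size_iota.
have -> : [set` iota 0 n] = `I_n.
  by apply/seteqP; split=> k /=; rewrite mem_iota add0n.
by move=> ->; elim: n => [//|n IH]; rewrite iterS IH expeS.
Qed.

End independence.

(** * Measurability of the block maximum and of the loss *)

Lemma measurable_norm_le (R : realType) (c : R) :
  measurable [set x : R | `|x| <= c].
Proof.
have -> : [set x : R | `|x| <= c] = setT `&` (fun x => `|x|) @^-1` `]-oo, c].
  by rewrite setTI; apply/seteqP; split=> x /=; rewrite in_itv.
by apply: normr_measurable => //; exact: measurable_itv.
Qed.

Section loss_measurability.
Context {d : measure_display} {T : measurableType d} {R : realType}.

Lemma measurable_bigminr (I : Type) (s : seq I) (a : T -> R) (F : I -> T -> R) :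
  measurable_fun setT a -> (forall i, measurable_fun setT (F i)) ->
  measurable_fun setT (fun t => \big[Num.min/a t]_(i <- s) F i t).
Proof.
move=> ma mF; elim: s => [|i s IH].
  by under eq_fun do rewrite big_nil.
by under eq_fun do rewrite big_cons; exact: measurable_minr.
Qed.

Lemma measurable_bigmaxr (I : Type) (s : seq I) (a : T -> R) (F : I -> T -> R) :
  measurable_fun setT a -> (forall i, measurable_fun setT (F i)) ->
  measurable_fun setT (fun t => \big[Num.max/a t]_(i <- s) F i t).
Proof.
move=> ma mF; elim: s => [|i s IH].
  by under eq_fun do rewrite big_nil.
by under eq_fun do rewrite big_cons; exact: measurable_maxr.
Qed.

Lemma measurable_phi (B : 'I_8 -> R) (z M : T -> R) :
  measurable_fun setT z -> measurable_fun setT M ->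
  measurable_fun setT (fun t => phi B (z t) (M t)).
Proof.
move=> mz mM.
have msq b : measurable_fun setT (fun t => (z t - M t * b) ^+ 2).
  apply: measurable_funX; apply: measurable_funB => //.
  by apply: measurable_funM => //; exact: measurable_cst.
by apply: measurable_bigminr => // j; exact: msq.
Qed.

Variable X : nat -> T -> R.
Hypothesis Xmeas : forall i, measurable_fun setT (X i).

Let mXnorm i : measurable_fun setT (fun t => `|X i t|).
Proof. by apply: measurableT_comp. Qed.

Lemma measurable_blockmax n :
  measurable_fun setT (fun t => blockmax (Xblock X n t)).
Proof.
apply: measurable_bigmaxr => [|i]; first exact: measurable_cst.
exact: mXnorm.
Qed.

Lemma measurable_blockloss B n :
  measurable_fun setT (fun t => blockloss B (Xblock X n t)).
Proof.
under eq_fun do rewrite blocklossE.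
apply: measurable_funM; first exact: measurable_cst.
apply: measurable_sum => i; apply: measurable_phi.
  exact: mXnorm.
exact: measurable_blockmax.
Qed.

End loss_measurability.

(** * The risk gap when every entry is bounded by [m] at every point *)

Section bounded_case.
Context {d : measure_display} {T : measurableType d} {R : realType}.
Variables (P : probability T R) (X : nat -> T -> R) (m : R).
Hypotheses (Xmeas : forall i, measurable_fun setT (X i))
  (Xind : mutually_independent P X) (Xid : identically_distributed P X)
  (m_ge0 : 0 <= m) (Xm : forall i t, `|X i t| <= m)
  (m_sup : forall e, 0 < e -> (P [set t | (`|X 0%N t| <= m - e)%R] < 1)%E).

Local Notation L B n := (fun t => blockloss B (Xblock X n.+1 t)).
Local Notation D n := (fun t => m - blockmax (Xblock X n.+1 t)).

Let XmB n t (i : 'I_n) : `|Xblock X n t i| <= m. Proof. exact: Xm. Qed.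

Let D_itv n t : 0 <= D n t <= m.
Proof.
by rewrite subr_ge0 blockmax_le//= lerBlDr lerDl blockmax_ge0.
Qed.

Let bmD n : bmfun (D n).
Proof.
split.
  by apply: measurable_funB; [exact: measurable_cst|exact: measurable_blockmax].
by exists m => t; have /andP[D0 Dm] := D_itv n t; rewrite ger0_norm.
Qed.

Let bmL B n : grid B -> bmfun (L B n).
Proof.
move=> gB; split; first exact: measurable_blockloss.
by exists (m ^+ 2) => t; rewrite ger0_norm ?blockloss_ge0// blockloss_le.
Qed.

(** The block loss with its random scale frozen at [m]: a mean of i.i.d. terms whose common
    expectation is [mu B]. *)
Let S B n t := n.+1%:R^-1 * \sum_(i < n.+1) phi B `|X i t| m.
Let mu B := \int[P]_t phi B `|X 0%N t| m.

Let mphi B : measurable_fun setT (fun x : R => phi B `|x| m).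
Proof.
by apply: measurable_phi; [exact: normr_measurable|exact: measurable_cst].
Qed.

Let phi_itv B i t : grid B -> 0 <= phi B `|X i t| m <= m ^+ 2.
Proof. by move=> gB; rewrite phi_ge0 phi_le// normr_ge0 Xm. Qed.

Let bmphi B i : grid B -> bmfun (fun t => phi B `|X i t| m).
Proof.
move=> gB; split; first exact: (measurableT_comp (mphi B)).
by exists (m ^+ 2) => t; have /andP[p0 pm] := phi_itv i t gB; rewrite ger0_norm.
Qed.

Let bmS B n : grid B -> bmfun (S B n).
Proof.
move=> gB; apply: bmfunM; first exact: bmfun_cst.
by apply: bmfun_sum => i; exact: bmphi.
Qed.

Let expphi B i : \int[P]_t phi B `|X i t| m = mu B.
Proof.
congr fine; apply: (ge0_integral_identically_distributed Xmeas Xid i (mphi B)).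
by move=> x; exact: phi_ge0.
Qed.

Let expS B n : grid B -> \int[P]_t S B n t = mu B.
Proof.
move=> gB; rewrite bmfun_expZ; last by apply: bmfun_sum => i; exact: bmphi.
rewrite bmfun_exp_sum; last by move=> i; exact: bmphi.
under eq_bigr do rewrite expphi.
by rewrite sumr_const card_ord -(mulr_natl (mu B)) mulKf// pnatr_eq0.
Qed.

Let varS B n : grid B ->
  \int[P]_t ((S B n t - mu B) ^+ 2) <= (m ^+ 2) ^+ 2 / n.+1%:R.
Proof.
move=> gB; apply: (variance_mean_le (Y := fun i t => phi B `|X i t| m)).
- by move=> i; have [] := bmphi i gB.
- by move=> i t; exact: phi_itv.
- rewrite Rintegral_ge0 /= => [|t _]; last exact: phi_ge0.
  apply: bmfun_exp_le => [|t]; first exact: bmphi.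
  by have /andP[] := phi_itv 0 t gB.
- by move=> i; exact: expphi.
- move=> i j ij; rewrite /Rintegral.
  rewrite (ge0_integral_independentM Xmeas Xind ij (mphi B)); last first.
    by move=> x; exact: phi_ge0.
  rewrite fineM ?integrable_fin_num//; try exact/bmfun_integrable/bmphi.
  by rewrite expr2; congr (_ * _); exact: expphi.
Qed.

(** Either all entries are at most [m - e] in absolute value, an event of geometrically small
    probability on which the defect is at most [m], or some entry exceeds [m - e] and the defect is
    below [e]. *)
Let expD n e : 0 < e ->
  \int[P]_t D n t <= e + m * fine (P [set t | `|X 0%N t| <= m - e]) ^+ n.+1.
Proof.
move=> e0; pose A := [set x : R | `|x| <= m - e].
have mA : measurable A by exact: measurable_norm_le.
pose C := \bigcap_(i in `I_n.+1) X i @^-1` A.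
have mC : measurable C.
  apply: bigcap_measurable => [|i _]; first by exists 0%N.
  rewrite -[_ @^-1` _]setTI.
  exact: Xmeas.
have PC : fine (P C) = fine (P [set t | `|X 0%N t| <= m - e]) ^+ n.+1.
  rewrite /C independent_bigcap// -[X in (X ^+ _)%E]fineK -?EFin_expe//.
  by apply: fin_num_measure; rewrite -[_ @^-1` _]setTI; exact: Xmeas.
rewrite -PC -exp_indic// -bmfun_expZ; last exact: bmfun_indic.
rewrite -[X in X + _](exp_cst P) -bmfun_expD; [|exact: bmfun_cst|]; last first.
  by apply: bmfunM; [exact: bmfun_cst|exact: bmfun_indic].
apply: bmfun_le_exp => //.
  apply: bmfunD; first exact: bmfun_cst.
  by apply: bmfunM; [exact: bmfun_cst|exact: bmfun_indic].
move=> t; rewrite indicE; have /andP[D0 Dm] := D_itv n t.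
have [Ct|nCt] := boolP (t \in C).
  by rewrite mulr1 (le_trans Dm)// lerDr ltW.
(* A defect above [e] would put every entry below [m - e], hence [t] in [C]. *)
rewrite mulr0 addr0 leNgt; apply/negP => eD; move/negP: nCt; apply.
rewrite inE => i /= ni; rewrite /A /=.
apply: le_trans (le_blockmax (Xblock X n.+1 t) (Ordinal ni)) _.
by move: eD; rewrite ltrBrDr -ltrBrDl => /ltW.
Qed.

Let expL_le B n : grid B ->
  \int[P]_t L B n t <= mu B + 2 * m * \int[P]_t D n t.
Proof.
move=> gB; rewrite -(expS n gB) -bmfun_expZ// -bmfun_expD//; last 2 first.
- exact: bmS.
- by apply: bmfunM => //; exact: bmfun_cst.
apply: bmfun_le_exp; first exact: bmL.
  by apply: bmfunD; [exact: bmS|apply: bmfunM => //; exact: bmfun_cst].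
move=> t; have := blockloss_approx gB (@XmB n.+1 t).
by rewrite ler_distlC lerBlDr => /andP[].
Qed.

(** Turns a variance bound into a bound on the mean absolute deviation without square roots; after
    scaling by [e] it is a weak form of the inequality between arithmetic and geometric means. *)
Let norm_le_sqr (e y : R) : 0 < e -> `|y| <= e + e^-1 * y ^+ 2.
Proof.
move=> e0; rewrite -(ler_pM2l e0) mulrDr mulrA divff ?gt_eqF// mul1r.
rewrite -real_normK ?num_real//; have := normr_ge0 y; nra.
Qed.

(** The comparison is made pointwise and then integrated: one random error [W] covers both grids, so
    it does not matter which of them the block selects. *)
Let expmin_ge B1 B2 n e : grid B1 -> grid B2 -> 0 < e ->
  Num.min (mu B1) (mu B2) <= \int[P]_t Num.min (L B1 n t) (L B2 n t)
    + (2 * e + 2 * (e^-1 * ((m ^+ 2) ^+ 2 / n.+1%:R))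
       + 2 * m * \int[P]_t D n t).
Proof.
move=> g1 g2 e0.
pose V B t := (S B n t - mu B) ^+ 2.
have bV B : grid B -> bmfun (V B).
  by move=> gB; apply/bmfunX2/bmfunB; [exact: bmS|exact: bmfun_cst].
have bmin : bmfun (fun t => Num.min (L B1 n t) (L B2 n t)).
  by apply: bmfun_min; exact: bmL.
(* The squared deviations are added rather than maximised, so that [varS] bounds each expectation
   separately. *)
pose W t := 2 * e + e^-1 * (V B1 t + V B2 t) + 2 * m * D n t.
have bVV : bmfun (fun t => V B1 t + V B2 t) by apply: bmfunD; exact: bV.
have bVe : bmfun (fun t => e^-1 * (V B1 t + V B2 t)).
  by apply: bmfunM => //; exact: bmfun_cst.
have beV : bmfun (fun t => 2 * e + e^-1 * (V B1 t + V B2 t)).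
  by apply: bmfunD => //; exact: bmfun_cst.
have bDm : bmfun (fun t => 2 * m * D n t).
  by apply: bmfunM => //; exact: bmfun_cst.
have bW : bmfun W by exact: bmfunD.
have EW : \int[P]_t W t <=
    2 * e + 2 * (e^-1 * ((m ^+ 2) ^+ 2 / n.+1%:R)) + 2 * m * \int[P]_t D n t.
  rewrite (bmfun_expD P beV bDm) (bmfun_expZ P (2 * m) (bmD n)) lerD2r.
  rewrite (bmfun_expD P (bmfun_cst (2 * e)) bVe) exp_cst lerD2l.
  rewrite (bmfun_expZ P e^-1 bVV) mulrCA ler_pM2l ?invr_gt0//.
  rewrite (bmfun_expD P (bV _ g1) (bV _ g2)).
  by rewrite mulrDl mul1r lerD// varS.
apply: le_trans (lerD (lexx _) EW); rewrite -bmfun_expD// -[leLHS](exp_cst P).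
apply: bmfun_le_exp; [exact: bmfun_cst|exact: bmfunD|move=> t].
(* From [mu B] to [S B n t] by [norm_le_sqr], then to the loss by [blockloss_approx]. *)
have H B : grid B -> mu B <= L B n t + (e + e^-1 * V B t + 2 * m * D n t).
  move=> gB; have := blockloss_approx gB (@XmB n.+1 t).
  rewrite ler_distlC => /andP[_ SL].
  have /ler_normlP[_ ] := norm_le_sqr (mu B - S B n t) e0.
  rewrite -[X in e^-1 * X]sqrrN opprB -/(V B t) => muS.
  move: SL muS; rewrite -/(S B n t); lra.
have V0 B : 0 <= e^-1 * V B t by rewrite mulr_ge0 ?sqr_ge0// invr_ge0 ltW.
have := H _ g1; have := H _ g2; have := V0 B1; have := V0 B2.
rewrite /W mulrDr addr_minl le_min !ge_min; lra.
Qed.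

(** Freezing the scale costs [2 * m] times the mean defect on each side, [4 * m] in all; [expD]
    splits this into [4 * m * e] and the geometric term. The remaining [2 * e] and the term in
    [n.+1%:R^-1] come from [expmin_ge]. *)
Lemma risk_gap_le B1 B2 n e : grid B1 -> grid B2 -> 0 < e ->
  Num.min (\int[P]_t L B1 n t) (\int[P]_t L B2 n t) <=
  \int[P]_t Num.min (L B1 n t) (L B2 n t)
    + ((2 + 4 * m) * e + (2 * (e^-1 * (m ^+ 2) ^+ 2) * n.+1%:R^-1
    + 4 * m ^+ 2 * fine (P [set t | `|X 0%N t| <= m - e]) ^+ n.+1)).
Proof.
move=> g1 g2 e0; have L1 := expL_le n g1; have L2 := expL_le n g2.
have LL := expmin_ge n g1 g2 e0; have DD := expD n e0.
apply: (@le_trans _ _ (Num.min (mu B1) (mu B2) + 2 * m * \int[P]_t D n t)).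
  by rewrite addr_minl le_min !ge_min L1 L2 orbT.
have mD : 4 * m * \int[P]_t D n t <= 4 * m *
    (e + m * fine (P [set t | `|X 0%N t| <= m - e]) ^+ n.+1).
  by rewrite ler_wpM2l// mulr_ge0.
move: LL mD; set q := (fine _ ^+ _); set k := (_%:R^-1 : R).
move: (\int[P]_t Num.min _ _) (\int[P]_t D n t) q k => i1 i2 q k; lra.
Qed.

Let bmmin B1 B2 n : grid B1 -> grid B2 ->
  bmfun (fun t => Num.min (L B1 n t) (L B2 n t)).
Proof. by move=> g1 g2; apply: bmfun_min; exact: bmL. Qed.

(** Losses are bounded, so the infimum may be taken over real expectations; likewise for two grids
    below. *)
Let RstarE n : Rstar P X n.+1 =
  ereal_inf [set (\int[P]_t L B n t)%:E | B in [set B | grid B]].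
Proof.
congr ereal_inf; apply/seteqP; split=> _ [B gB <-]; exists B => //;
  by rewrite bmfun_expE//; exact: bmL.
Qed.

Let RPO2starE n : RPO2star P X n.+1 =
  ereal_inf [set (\int[P]_t Num.min (L BB.1 n t) (L BB.2 n t))%:E |
    BB in [set BB : ('I_8 -> R) * ('I_8 -> R) | grid BB.1 /\ grid BB.2]].
Proof.
congr ereal_inf; apply/seteqP; split=> _ [[B1 B2] [g1 g2] <-];
  by exists (B1, B2) => //; rewrite bmfun_expE//; exact: bmmin.
Qed.

Let Rstar_fin n : Rstar P X n.+1 \is a fin_num.
Proof.
rewrite RstarE fin_numElt; apply/andP; split.
- apply: (@lt_le_trans _ _ 0%E); first exact: ltNyr.
  apply: le_ereal_inf_tmp => _ [B _ <-]; rewrite lee_fin Rintegral_ge0// => t _.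
  exact: blockloss_ge0.
- apply: le_lt_trans (ereal_inf_lbound _) (ltry _).
  by exists (fun j => (j == ord_max)%:R) => //; exact: trivial_grid.
Qed.

Let RPO2star_fin n : RPO2star P X n.+1 \is a fin_num.
Proof.
rewrite RPO2starE fin_numElt; apply/andP; split.
- apply: (@lt_le_trans _ _ 0%E); first exact: ltNyr.
  apply: le_ereal_inf_tmp => _ [B _ <-]; rewrite lee_fin Rintegral_ge0// => t _.
  by rewrite le_min !blockloss_ge0.
- pose B0 : 'I_8 -> R := fun j => (j == ord_max)%:R.
  apply: le_lt_trans (ereal_inf_lbound _) (ltry _).
  by exists (B0, B0) => //=; split; exact: trivial_grid.
Qed.

(** A single grid is the pair [(B, B)]. *)
Let RPO2star_le n : (RPO2star P X n.+1 <= Rstar P X n.+1)%E.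
Proof.
rewrite RstarE RPO2starE; apply: le_ereal_inf_tmp => _ [B gB <-].
apply: ereal_inf_lbound; exists (B, B) => //=.
by congr EFin; apply: eq_Rintegral => t _; rewrite minxx.
Qed.

(** The error in [risk_gap_le] is the same for all pairs of grids, so it survives the infimum over
    pairs. *)
Let Rstar_le n e : 0 < e -> (Rstar P X n.+1 <= RPO2star P X n.+1 +
  ((2 + 4 * m) * e + (2 * (e^-1 * (m ^+ 2) ^+ 2) * n.+1%:R^-1
    + 4 * m ^+ 2 * fine (P [set t | (`|X 0%N t| <= m - e)%R]) ^+ n.+1))%:E)%E.
Proof.
move=> e0; rewrite -leeBlDr// [leRHS]RPO2starE.
apply: le_ereal_inf_tmp => _ [[B1 B2] [g1 g2] <-]; rewrite leeBlDr// -EFinD.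
have := risk_gap_le n g1 g2 e0.
rewrite -lee_fin; apply: le_trans.
rewrite RstarE EFin_min le_min; apply/andP; split; apply: ereal_inf_lbound.
- by exists B1.
- by exists B2.
Qed.

Lemma bounded_risk_gap_cvg0 :
  (fun n : nat => (Rstar P X n.+1 - RPO2star P X n.+1)%E) @ \oo --> 0%E.
Proof.
pose r n := fine (Rstar P X n.+1) - fine (RPO2star P X n.+1).
have rE n : (Rstar P X n.+1 - RPO2star P X n.+1)%E = (r n)%:E.
  by rewrite EFinB !fineK.
under eq_fun do rewrite rE.
apply: cvg_EFin; first by apply: nearW.
apply/cvgrPdist_le => eps eps0.
have m1 : 0 < 4 + 8 * m by rewrite ltr_pwDl// mulr_ge0.
(* Chosen so that [(2 + 4 * m) * e] is half of [eps]; with [e] fixed, the rest of the error tends to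
   0 in [n]. *)
pose e := eps / (4 + 8 * m).
have e0 : 0 < e by rewrite divr_gt0.
have me : (2 + 4 * m) * e = eps / 2.
  by rewrite /e; field; rewrite gt_eqF.
pose q := fine (P [set t | `|X 0%N t| <= m - e]).
have mA : measurable [set t | `|X 0%N t| <= m - e].
  have := Xmeas 0%N measurableT (measurable_norm_le (m - e)).
  by rewrite setTI.
have q0 : 0 <= q by rewrite fine_ge0.
(* This is where [m] must be the essential supremum and not just a bound: it makes the geometric
   term vanish. *)
have q1 : q < 1.
  by rewrite -lte_fin fineK ?fin_num_measure//; exact: m_sup.
pose a n := 2 * (e^-1 * (m ^+ 2) ^+ 2) * n.+1%:R^-1 + 4 * m ^+ 2 * q ^+ n.+1.
have a0 : a n @[n --> \oo] --> (0 : R).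
  rewrite -[X in _ --> X](addr0 (0 : R)); apply: cvgD.
    rewrite -[X in _ --> X](mulr0 (2 * (e^-1 * (m ^+ 2) ^+ 2))).
    by apply: cvgMl_tmp; exact: cvg_harmonic.
  rewrite -[X in _ --> X](mulr0 (4 * m ^+ 2)).
  apply: cvgMl_tmp; rewrite (cvg_shiftS (fun n => q ^+ n)).
  by apply: cvg_expr; rewrite ger0_norm.
have eps20 : 0 < eps / 2 by rewrite divr_gt0.
move/cvgrPdist_le : a0 => /(_ _ eps20); apply: filterS => n.
rewrite !sub0r !normrN => an.
(* The gap is nonnegative, so an upper bound is enough. *)
have r0 : 0 <= r n by rewrite subr_ge0 fine_le.
rewrite ger0_norm// [eps]splitr.
have := Rstar_le n e0; rewrite -/q -/(a n) me => Rle.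
rewrite /r lerBlDl -lee_fin fineK// (le_trans Rle)// [leRHS]EFinD fineK//.
by rewrite leeD2l// lee_fin lerD2l (le_trans (ler_norm _)).
Qed.

End bounded_case.

(** * Reduction of almost sure boundedness to boundedness everywhere *)

Section truncation.
Context {d : measure_display} {T : measurableType d} {R : realType}.
Variables (P : probability T R) (X : nat -> T -> R) (m : R).
Hypotheses (Xmeas : forall i, measurable_fun setT (X i))
  (Xind : mutually_independent P X) (Xid : identically_distributed P X)
  (Xm : forall i, {ae P, forall t, `|X i t| <= m}).

(** A fixed Borel map applied to each entry, so the truncated sequence stays i.i.d.; under [Xm] it
    alters the entries only on null sets. *)
Definition trunc (x : R) := if `|x| <= m then x else 0.

Lemma measurable_trunc : measurable_fun setT trunc.
Proof.
apply: measurable_fun_ifT => //.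
apply: measurable_fun_ler; first exact: normr_measurable.
exact: measurable_cst.
Qed.

Let truncT (A : set R) : measurable A -> measurable (trunc @^-1` A).
Proof. by move=> mA; rewrite -[_ @^-1` _]setTI; exact: measurable_trunc. Qed.

Let X' i t := trunc (X i t).

Lemma measurable_trunc_comp i : measurable_fun setT (X' i).
Proof. exact: measurableT_comp measurable_trunc (Xmeas i). Qed.

Lemma trunc_independent : mutually_independent P X'.
Proof.
move=> S A uS mA; apply: (@Xind S (fun i => trunc @^-1` A i)) => // i.
exact: truncT.
Qed.

Lemma trunc_identically_distributed : identically_distributed P X'.
Proof. by move=> i A mA; apply: (@Xid i (trunc @^-1` A)); exact: truncT. Qed.

Lemma trunc_block_ae n :
  {ae P, forall t, Xblock X n t = Xblock X' n t}.
Proof.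
(* A countable union of null sets is null. *)
have : {ae P, forall t, forall i, `|X i t| <= m} by exact: ae_foralln.
apply: filterS => t Xt; apply/funext => i.
by rewrite /Xblock /X' /trunc Xt.
Qed.

Lemma Rstar_trunc n : Rstar P X n = Rstar P X' n.
Proof.
congr ereal_inf; apply/seteqP; split=> _ [B gB <-]; exists B => //;
  apply: ae_eq_integral => //;
  try exact/measurable_EFinP/measurable_blockloss;
  try exact/measurable_EFinP/measurable_blockloss/measurable_trunc_comp.
- by apply: filterS (trunc_block_ae n) => t -> _.
- by apply: filterS (trunc_block_ae n) => t -> _.
Qed.

Lemma RPO2star_trunc n : RPO2star P X n = RPO2star P X' n.
Proof.
have mm (Y : nat -> T -> R) B1 B2 : (forall i, measurable_fun setT (Y i)) ->
  measurable_fun setT (fun t => (Num.min (blockloss B1 (Xblock Y n t))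
     (blockloss B2 (Xblock Y n t)))%:E).
  move=> mY; apply/measurable_EFinP.
  by apply: measurable_minr; exact: measurable_blockloss.
congr ereal_inf; apply/seteqP; split=> _ [B gB <-]; exists B => //;
  apply: ae_eq_integral => //;
  try exact: mm; try exact/mm/measurable_trunc_comp.
- by apply: filterS (trunc_block_ae n) => t -> _.
- by apply: filterS (trunc_block_ae n) => t -> _.
Qed.

End truncation.

(** * The essential supremum and the conclusion *)

Lemma probability1_ae (d : measure_display) (T : measurableType d)
  (R : realType) (P : probability T R) (A : set T) : measurable A ->
  P A = 1%E <-> {ae P, forall t, A t}.
Proof.
move=> mA; split=> [PA|[N [mN PN AN]]].
  exists (~` A); split => //; first exact: measurableC.
  by rewrite probability_setC// PA subee.
apply/eqP; rewrite eq_le probability_le1//=.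
have -> : P A = (1 - P (~` A))%E.
  by rewrite -[in LHS](setCK A) probability_setC//; exact: measurableC.
rewrite (subset_measure0 _ mN)// ?sube0//; exact: measurableC.
Qed.

Unset Implicit Arguments.

Theorem theorem1 (d : measure_display) (T : measurableType d) (R : realType)
  (P : probability T R) (X : nat -> T -> R)
  (Xmeas : forall i, measurable_fun setT (X i))
  (Xind : mutually_independent P X)
  (Xid : identically_distributed P X)
  (xmax_finite : exists x : R, P [set t | `|X 0%N t| <= x] = 1%E) :
  (fun n : nat => (Rstar P X n.+1 - RPO2star P X n.+1)%E) @ \oo --> 0%E.
Proof.
have mXle i c : measurable [set t | `|X i t| <= c].
  have := Xmeas i measurableT _ (measurable_norm_le c).
  by rewrite setTI.
pose f t := (`|X 0%N t|)%:E : \bar R.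
have aeP c : {ae P, forall t, (f t <= c%:E)%E} <->
    P [set t | `|X 0%N t| <= c] = 1%E by rewrite probability1_ae.
(* Positive total mass lets the pointwise bound [0 <= f] pass to the essential supremum. *)
have PT0 : (0 < P [set: T])%E by rewrite probability_setT.
case: xmax_finite => x Px.
have s_ge0 : (0 <= ess_sup P f)%E.
  by apply: ess_sup_gee => //; apply: nearW => t; rewrite lee_fin.
have s_lex : (ess_sup P f <= x%:E)%E by apply/ess_supP/aeP.
have s_fin : ess_sup P f \is a fin_num.
  by rewrite ge0_fin_numE// (le_lt_trans s_lex)// ltry.
pose m := fine (ess_sup P f).
have mE : m%:E = ess_sup P f by rewrite /m fineK.
have m0 : 0 <= m by rewrite fine_ge0.
(* The essential supremum is itself an almost sure bound; identical distribution then carries it to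
   all entries. *)
have Pm : P [set t | `|X 0%N t| <= m] = 1%E.
  by apply/aeP/ess_supP; rewrite mE.
have Xm i : {ae P, forall t, `|X i t| <= m}.
  apply/(probability1_ae P (mXle i m)); rewrite -Pm.
  exact: (Xid i [set y | `|y| <= m] (measurable_norm_le m)).
under eq_fun do rewrite (Rstar_trunc Xmeas Xm) (RPO2star_trunc Xmeas Xm).
apply: (@bounded_risk_gap_cvg0 _ _ _ _ _ m) => //.
- exact: measurable_trunc_comp.
- exact: trunc_independent.
- exact: trunc_identically_distributed.
- by move=> i t; rewrite /trunc; case: ifP => //; rewrite normr0.
- move=> e e0; have mt : measurable [set t | `|trunc m (X 0%N t)| <= m - e].
    have := measurable_trunc_comp m Xmeas 0%N measurableT
      (measurable_norm_le (m - e)).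
    by rewrite setTI.
  (* Probability 1 would make [m - e] an almost sure bound for [|X 0|], which equals its truncation
     almost surely, contradicting the minimality of [m]. *)
  rewrite lt_neqAle probability_le1// andbT.
  apply/eqP => /(probability1_ae P mt) Pe.
  have /ess_supP : {ae P, forall t, (f t <= (m - e)%:E)%E}.
    by apply: filterS2 Pe (Xm 0%N) => t /= + Xt; rewrite /trunc Xt.
  by rewrite -mE lee_fin leNgt ltrBlDr ltrDl e0.
Qed.
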